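(* Let $K$ be a field of characteristic $0$ and let $E=\bigsqcup_{n\ge1}E_n$ be a graded set with each $E_n$ finite. Let $J'$ be the two-sided ideal of the magmatic algebra $(\mathcal T^E_{pl},\circ_{\searrow})$ of planar $E$-decorated rooted trees with the left Butcher product, generated by the pre-Lie elements $\sigma\circ_{\searrow}(\tau\circ_{\searrow}\rho)-(\sigma\circ_{\searrow}\tau)\circ_{\searrow}\rho-\tau\circ_{\searrow}(\sigma\circ_{\searrow}\rho)+(\tau\circ_{\searrow}\sigma)\circ_{\searrow}\rho$ and by all elements $|\sigma|\,\sigma\circ_{\searrow}\tau+|\tau|\,\tau\circ_{\searrow}\sigma$, where $\sigma,\tau,\rho\in T^E_{pl}$. Then the set $O(J')$ is a set of ladders; equivalently, $T(J')$ contains all the trees of $T^E_{pl}$ which are not ladders.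
   Context: $T^E_{pl}$ is the set of (non-empty) planar rooted trees with vertices decorated by $E$, and $\mathcal T^E_{pl}$ its $K$-linear span. $E_n=\{a^n_1,\dots,a^n_{d_n}\}$ is the set of generators of degree $n$; the degree $|\sigma|$ of a tree is the sum of the degrees of the decorations of its vertices. Writing a planar tree as $\tau=B_{+,a}(\tau_1\cdots\tau_k)$ (root decorated by $a$, branches $\tau_1,\dots,\tau_k$ from left to right), the left Butcher product is $\sigma\circ_{\searrow}\tau:=B_{+,a}(\sigma\tau_1\cdots\tau_k)$, extended bilinearly. A ladder is a tree in which every vertex has at most one child. The generators are ordered by $a^1_1<\cdots<a^1_{d_1}<a^2_1<\cdots<a^2_{d_2}<\cdots$. Let $b(\sigma)$ be the number of branches starting from the root of $\sigma$. The total order $\preceq$ on $T^E_{pl}$ is defined recursively: $\sigma\prec\tau$ iff (1) $|\sigma|<|\tau|$; or (2) $|\sigma|=|\tau|$ and $b(\sigma)<b(\tau)$; or (3) $|\sigma|=|\tau|$, $b(\sigma)=b(\tau)=k$ and, with $\sigma=B_{+,r}(\sigma_1\cdots\sigma_k)$, $\tau=B_{+,r'}(\tau_1\cdots\tau_k)$, $(\sigma_1,\dots,\sigma_k)$ is strictly smaller than $(\tau_1,\dots,\tau_k)$ lexicographically; or (4) $|\sigma|=|\tau|$, $b(\sigma)=b(\tau)$, $(\sigma_1,\dots,\sigma_k)=(\tau_1,\dots,\tau_k)$ and $r<r'$. And $\sigma\preceq\tau$ means $\sigma\prec\tau$ or $\sigma=\tau$. For $0\ne f\in\mathcal T^E_{pl}$,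 $T(f)$ is the $\preceq$-maximal tree occurring in $f$ with nonzero coefficient. For a two-sided ideal $I$, $T(I):=\{T(f):0\ne f\in I\}\subset T^E_{pl}$ and $O(I):=T^E_{pl}\setminus T(I)$. *)

(* Defs.v *)
From HB Require Import structures.
From mathcomp Require Import all_boot all_algebra.
From mathcomp Require Export finmap.
From mathcomp.multinomials Require Export monalg.

Set Implicit Arguments.
Unset Strict Implicit.
Unset Printing Implicit Defensive.

Import GRing.Theory.
Local Open Scope ring_scope.

(* [gens n] is the enumeration a^n_1, ..., a^n_{d_n} of E_n. *)
Record gradedSet := GradedSet {
  gs_sort :> choiceType;
  gdeg : gs_sort -> nat;
  gens : nat -> seq gs_sort;
  gdeg_gt0 : forall a, (0 < gdeg a)%N;
  gens_uniq : forall n, uniq (gens n);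
  mem_gens : forall n a, (a \in gens n) = (gdeg a == n)
}.

Definition gen_lt (E : gradedSet) (a b : E) : bool :=
  (gdeg a < gdeg b)%N ||
  (gdeg a == gdeg b) &&
    (index a (gens E (gdeg a)) < index b (gens E (gdeg b)))%N.

(* [Node a [:: t1; ...; tk]] is B_{+,a}(t1 ... tk). *)
Inductive ptree (E : Type) : Type := Node of E & seq (ptree E).

Section TreeChoice.
Variable E : choiceType.

Fixpoint ptree_enc (t : ptree E) : GenTree.tree E :=
  let: Node a ts := t in
  GenTree.Node 0 (GenTree.Leaf a :: map ptree_enc ts).

Fixpoint ptree_dec (t : GenTree.tree E) : option (ptree E) :=
  if t is GenTree.Node _ (GenTree.Leaf a :: ts)
  then Some (Node a (pmap ptree_dec ts)) else None.

Fact ptree_encK : pcancel ptree_enc ptree_dec.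
Proof.
rewrite /pcancel; fix IH 1; case=> a ts /=; congr (Some (Node a _)).
by elim: ts => //= t ts IHts; rewrite IH /= IHts.
Qed.

HB.instance Definition _ := Choice.copy (ptree E) (pcan_type ptree_encK).

End TreeChoice.

Section Trees.
Variable E : gradedSet.
Implicit Types s t : ptree E.

Fixpoint tdeg t : nat :=
  let: Node a ts := t in (gdeg a + sumn (map tdeg ts))%N.

Definition nbranches t : nat := let: Node _ ts := t in size ts.

Fixpoint is_ladder t : bool :=
  let: Node _ ts := t in (size ts <= 1)%N && all is_ladder ts.

(* In [tree_lt_lex], p is the longest common prefix of the branch sequences. *)
Inductive tree_lt : ptree E -> ptree E -> Prop :=
| tree_lt_deg s t :
    (tdeg s < tdeg t)%N -> tree_lt s t
| tree_lt_branches s t :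
    tdeg s = tdeg t -> (nbranches s < nbranches t)%N -> tree_lt s t
| tree_lt_lex r r' p x y ss ts :
    tdeg (Node r (p ++ x :: ss)) = tdeg (Node r' (p ++ y :: ts)) ->
    size ss = size ts -> tree_lt x y ->
    tree_lt (Node r (p ++ x :: ss)) (Node r' (p ++ y :: ts))
| tree_lt_root r r' ss :
    tdeg (Node r ss) = tdeg (Node r' ss) -> gen_lt r r' ->
    tree_lt (Node r ss) (Node r' ss).

Definition tree_le s t : Prop := tree_lt s t \/ s = t.

Definition tree_butcher s t : ptree E :=
  let: Node a ts := t in Node a (s :: ts).

End Trees.

Section Magmatic.
Variables (K : fieldType) (E : gradedSet).

(* {malg K[ptree E]} is used only as the free K-module on trees, with basis
   << t >>; the product is [butcher]. *)
Definition butcher (f g : {malg K[ptree E]}) : {malg K[ptree E]} :=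
  \sum_(s <- msupp f) \sum_(t <- msupp g)
     << f@_s * g@_t *g tree_butcher s t >>.

Record two_sided_ideal (I : {malg K[ptree E]} -> Prop) : Prop := {
  ideal0 : I 0;
  idealD : forall f g, I f -> I g -> I (f + g);
  idealZ : forall (c : K) f, I f -> I (c *: f);
  ideal_mull : forall f g, I g -> I (butcher f g);
  ideal_mulr : forall f g, I f -> I (butcher f g)
}.

Definition ideal_generated (G : {malg K[ptree E]} -> Prop)
    (f : {malg K[ptree E]}) : Prop :=
  forall I, two_sided_ideal I -> (forall g, G g -> I g) -> I f.

Definition pre_lie_elt (f g h : {malg K[ptree E]}) : {malg K[ptree E]} :=
  butcher f (butcher g h) - butcher (butcher f g) h
  - butcher g (butcher f h) + butcher (butcher g f) h.

Definition weighted_elt (s t : ptree E) : {malg K[ptree E]} :=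
  (tdeg s)%:R *: butcher << s >> << t >>
  + (tdeg t)%:R *: butcher << t >> << s >>.

Inductive Jprime_gen : {malg K[ptree E]} -> Prop :=
| Jprime_pre_lie s t r : Jprime_gen (pre_lie_elt << s >> << t >> << r >>)
| Jprime_weighted s t : Jprime_gen (weighted_elt s t).

Definition Jprime : {malg K[ptree E]} -> Prop := ideal_generated Jprime_gen.

(* [is_max_tree f t] is T(f) = t. *)
Definition is_max_tree (f : {malg K[ptree E]}) (t : ptree E) : Prop :=
  t \in msupp f /\ forall s, s \in msupp f -> tree_le s t.

(* T(I) and O(I), as predicates on trees. *)
Definition leading_trees (I : {malg K[ptree E]} -> Prop) (t : ptree E) : Prop :=
  exists f, [/\ f != 0, I f & is_max_tree f t].

Definition normal_trees (I : {malg K[ptree E]} -> Prop) (t : ptree E) : Prop :=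
  ~ leading_trees I t.

End Magmatic.

Arguments Jprime : clear implicits.

(* Main.v *)
Require Import Defs.
From mathcomp Require Import all_boot all_algebra.
From mathcomp.multinomials Require Import monalg.

(** Write [s o t] for the left Butcher product of trees.  Two facts carry the
    proof.

    Straightening ([ladder_butcher_reduction]): if [s] is a ladder and [u] any
    tree, then modulo J' the tree [s o u] is a linear combination of trees of
    the same degree whose root has exactly one branch.  A weighted generator,
    divided by [|s|] (invertible in characteristic 0), turns [s o u] into a
    multiple of [u o s].  If [s] is a single vertex, [u o s] has one branch.
    Otherwise [s = s' o b] with [b] a vertex and [s'] a shorter ladder, and the
    pre-Lie relation reads
      [u o (s' o b) = (u o s') o b - (s' o u) o b + s' o (u o b)];
    the first two terms have one branch, and the last one is straightened by
    induction on the length of [s], the statement being for all [u].  So when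
    [u] has at least one branch, [s o u] is a leading tree: at equal degree the
    order compares numbers of branches first.

    Stability ([leading_trees_butcherl]): [s |-> s o u] is strictly increasing,
    so leading trees of J' remain leading after a product with [u] on the right.

    Now let [t = t1 o u] be a tree that is not a ladder, [t1] being its leftmost
    branch.  If [t1] is a ladder then [u] has a branch and straightening
    applies; otherwise [t1] is a leading tree by induction, hence so is [t]. *)

Set Implicit Arguments.
Unset Strict Implicit.
Unset Printing Implicit Defensive.

Import GRing.Theory.
Local Open Scope ring_scope.

(** * Identities in modules *)

Lemma scalerVDr (K : fieldType) (V : lmodType K) (a b : K) (x y : V) :
  a != 0 -> a^-1 *: (a *: x + b *: y) = x + (a^-1 * b) *: y.
Proof. by move=> nz_a; rewrite scalerDr !scalerA mulVf // scale1r. Qed.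

Lemma subrCADB (V : zmodType) (a b c d e : V) :
  a - b - c + d + (c - e) = a - (b - d + e).
Proof. by rewrite (addrAC _ (- c)) addrA subrK !opprD opprK !addrA. Qed.

(** * Trees and their order *)

Section Trees.
Variable E : gradedSet.
Implicit Types s t u : ptree E.

Lemma tdeg_gt0 t : (0 < tdeg t)%N.
Proof. by case: t => a ts /=; rewrite addn_gt0 gdeg_gt0. Qed.

Lemma tdeg_butcher s t : tdeg (tree_butcher s t) = (tdeg s + tdeg t)%N.
Proof. by case: t => a ts /=; rewrite addnCA. Qed.

Lemma nbranches_butcher s t : nbranches (tree_butcher s t) = (nbranches t).+1.
Proof. by case: t. Qed.

Lemma tree_butcher_injl u : injective (fun s => tree_butcher s u).
Proof. by case: u => a us s t [->]. Qed.

Lemma tree_lt_tdeg s t : tree_lt s t -> (tdeg s <= tdeg t)%N.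
Proof.
by case=> {s t} [s t /ltnW //|s t -> //|? ? ? ? ? ? ? -> //|? ? ? -> //]. Qed.

(** At equal degrees, [s] and [t] are the first entries where the branch
    sequences of [s o u] and [t o u] differ. *)
Lemma tree_lt_butcherl u s t :
  tree_lt s t -> tree_lt (tree_butcher s u) (tree_butcher t u).
Proof.
move=> lt_st; have := tree_lt_tdeg lt_st.
rewrite leq_eqVlt => /orP[/eqP eq_st | lt_deg]; last first.
  by apply: tree_lt_deg; rewrite !tdeg_butcher ltn_add2r.
have := tdeg_butcher s u; rewrite eq_st -tdeg_butcher.
case: u => a us eq_deg.
exact: (@tree_lt_lex E a a [::] s t us us).
Qed.

End Trees.

(** * The ideal J' and the Butcher product on basis elements *)

Section Jprime.
Variables (K : fieldType) (E : gradedSet).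
Implicit Types (s t u : ptree E) (f g : {malg K[ptree E]}).

Lemma Jprime_ideal : two_sided_ideal (Jprime K E).
Proof.
split.
- by move=> I idI _; apply: ideal0.
- by move=> f g Jf Jg I idI genI; apply: idealD; [| apply: Jf | apply: Jg].
- by move=> c f Jf I idI genI; apply: idealZ => //; apply: Jf.
- by move=> f g Jg I idI genI; apply: ideal_mull => //; apply: Jg.
- by move=> f g Jf I idI genI; apply: ideal_mulr => //; apply: Jf.
Qed.

Lemma Jprime_of_gen f : Jprime_gen f -> Jprime K E f.
Proof. by move=> genf I _; apply. Qed.

Lemma butcherUr f u :
  butcher f << u >> = \sum_(s <- msupp f) << f@_s *g tree_butcher s u >>.
Proof.
apply: eq_bigr => s _.
by rewrite msuppU oner_eq0 big_seq_fset1 mcoeffUU mulr1.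
Qed.

Lemma butcherUU s t :
  butcher << s >> << t >> = << tree_butcher s t >> :> {malg K[ptree E]}.
Proof. by rewrite butcherUr msuppU oner_eq0 big_seq_fset1 mcoeffUU. Qed.

(** No two terms of the sum [butcherUr] cancel, as [s |-> s o u] is injective. *)
Lemma mcoeff_butcherUr f s u : (butcher f << u >>)@_(tree_butcher s u) = f@_s.
Proof.
rewrite butcherUr raddf_sum /= [in RHS](monalgE f) raddf_sum /=.
apply: eq_bigr => t _.
by rewrite !mcoeffU (inj_eq (@tree_butcher_injl E u)).
Qed.

Lemma msupp_butcherUr f u x :
  x \in msupp (butcher f << u >>) ->
  exists2 s, s \in msupp f & x = tree_butcher s u.
Proof.
rewrite -mcoeff_neq0 butcherUr raddf_sum /= => nz_x.
case: (boolP (has (fun s => tree_butcher s u == x) (msupp f))).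
  by case/hasP => s fs /eqP <-; exists s.
move/hasPn => no_s; case/eqP: nz_x; rewrite big_seq big1 // => s /no_s.
by rewrite mcoeffU => /negPf ->.
Qed.

Lemma leading_trees_butcherl t u :
  leading_trees (Jprime K E) t -> leading_trees (Jprime K E) (tree_butcher t u).
Proof.
case=> f [_ Jf [ft max_t]].
have ftu : tree_butcher t u \in msupp (butcher f << u >>).
  by rewrite -mcoeff_neq0 mcoeff_butcherUr mcoeff_neq0.
exists (butcher f << u >>); split.
- by apply: contraTneq ftu => ->; rewrite msupp0 in_fset0.
- exact: (ideal_mulr Jprime_ideal).
- split=> // _ /msupp_butcherUr[s fs ->].
  case: (max_t s fs) => [lt_st | ->]; last by right.
  by left; apply: tree_lt_butcherl.
Qed.

(** * Straightening modulo J' *)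

(** The remainders of straightening: every tree in the support of such a [g] is
    smaller than any tree of degree [d] with at least two branches. *)
Definition one_branch_of_degree (d : nat) g : Prop :=
  forall s, s \in msupp g -> tdeg s = d /\ nbranches s = 1%N.

Lemma one_branchU d s :
  tdeg s = d -> nbranches s = 1%N -> one_branch_of_degree d << s >>.
Proof. by move=> ds bs t; rewrite msuppU oner_eq0 in_fset1 => /eqP ->. Qed.

Lemma one_branchD d f g :
  one_branch_of_degree d f -> one_branch_of_degree d g ->
  one_branch_of_degree d (f + g).
Proof.
move=> obf obg s /(fsubsetP (msuppD_le _ _)).
by rewrite in_fsetU => /orP[/obf|/obg].
Qed.

Lemma one_branchB d f g :
  one_branch_of_degree d f -> one_branch_of_degree d g ->
  one_branch_of_degree d (f - g).
Proof. by move=> obf obg; apply: one_branchD => // s; rewrite msuppN => /obg. Qed.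

Lemma one_branchZ d (c : K) f :
  one_branch_of_degree d f -> one_branch_of_degree d (c *: f).
Proof. by move=> obf s /(fsubsetP (msuppZ_le _ _))/obf. Qed.

Lemma one_branch_leading t g :
  (1 < nbranches t)%N -> one_branch_of_degree (tdeg t) g ->
  Jprime K E (<< t >> - g) -> leading_trees (Jprime K E) t.
Proof.
move=> bt obg Jtg.
have ft : t \in msupp (<< t >> - g).
  rewrite -mcoeff_neq0 mcoeffB mcoeffUU mcoeff_outdom ?subr0 ?oner_eq0 //.
  by apply/negP => /obg[_ b1]; rewrite b1 in bt.
exists (<< t >> - g); split=> //.
  by apply: contraTneq ft => ->; rewrite msupp0 in_fset0.
split=> // s /(fsubsetP (msuppB_le _ _)).
rewrite in_fsetU msuppU oner_eq0 in_fset1 => /orP[/eqP -> | /obg[ds bs]].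
  by right.
by left; apply: tree_lt_branches; rewrite ?bs.
Qed.

Hypothesis charK0 : [pchar K] =i pred0.

(** Exchanging the factors of a product costs a scalar: this is the only place
    where characteristic 0 matters. *)
Lemma Jprime_swap s u :
  Jprime K E (<< tree_butcher s u >>
              + ((tdeg s)%:R^-1 * (tdeg u)%:R) *: << tree_butcher u s >>).
Proof.
have nz_s : (tdeg s)%:R != 0 :> K.
  by rewrite (proj1 (pcharf0P K) charK0) -lt0n tdeg_gt0.
have := idealZ Jprime_ideal (tdeg s)%:R^-1
  (Jprime_of_gen (Jprime_weighted K s u)).
by rewrite /weighted_elt !butcherUU scalerVDr.
Qed.

(** The tree [u] is arbitrary because the induction on the ladder [s] replaces
    [u] by [u o b], where [b] is the root of [s]. *)
Lemma ladder_butcher_reduction s u :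
  is_ladder s ->
  exists2 g, one_branch_of_degree (tdeg s + tdeg u) g
    & Jprime K E (<< tree_butcher s u >> - g).
Proof.
move: s u; fix IH 1 => -[b [|s' [|//]]] u /=.
  move=> _; have := Jprime_swap (Node b [::]) u.
  set c := _^-1 * _ => Jsw; exists (- c *: << tree_butcher u (Node b [::]) >>).
    apply: one_branchZ; apply: one_branchU; rewrite ?nbranches_butcher //.
    by rewrite tdeg_butcher /= addnC.
  by rewrite scaleNr opprK.
rewrite andbT => lad_s'.
set vb := Node b [::]; set s := Node b [:: s'].
have [g' obg' Jg'] := IH s' (tree_butcher u vb) lad_s'.
have Jsw := Jprime_swap s u.
have Jpl := Jprime_of_gen (Jprime_pre_lie K u s' vb).
(* The ladder [s] is [s' o vb], so [U - A - C + B] below is in J'. *)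
rewrite /pre_lie_elt !butcherUU -[tree_butcher s' vb]/s in Jpl.
move: Jsw Jpl Jg'; set c := _^-1 * _.
set A := << tree_butcher (tree_butcher u s') vb >>.
set B := << tree_butcher (tree_butcher s' u) vb >>.
set U := << tree_butcher u s >>.
set C := << tree_butcher s' (tree_butcher u vb) >> => Jsw Jpl Jg'.
exists (- c *: (A - B + g')).
  have deg_s : tdeg s = (tdeg s' + gdeg b)%N by rewrite /= addn0 addnC.
  rewrite -[(gdeg b + _)%N]/(tdeg s) deg_s.
  apply: one_branchZ; apply: one_branchD; first apply: one_branchB.
  - apply: one_branchU; rewrite ?nbranches_butcher // !tdeg_butcher /=.
    by rewrite addn0 [(tdeg u + tdeg s')%N]addnC addnAC.
  - apply: one_branchU; rewrite ?nbranches_butcher // !tdeg_butcher /=.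
    by rewrite addn0 addnAC.
  - by move: obg'; rewrite tdeg_butcher /= addn0 [(tdeg u + _)%N]addnC addnA.
(* [Jsw] replaces [s o u] by [- c U], [Jpl] then [U] by [A - B + C], and [Jg']
   finally [C] by [g']. *)
have := idealD Jprime_ideal Jsw
  (idealZ Jprime_ideal (- c) (idealD Jprime_ideal Jpl Jg')).
by rewrite subrCADB scalerBr addrA (scaleNr c U) addrK.
Qed.

(** * Trees that are not ladders *)

Lemma leading_trees_not_ladder t :
  ~~ is_ladder t -> leading_trees (Jprime K E) t.
Proof.
move: t; fix IH 1 => -[a [//|t1 ts]].
case: (boolP (is_ladder t1)) => [lad_t1 | /IH lead_t1 _]; last first.
  exact: (leading_trees_butcherl (Node a ts) lead_t1).
case: ts => [|t2 ts _]; first by rewrite /= lad_t1.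
have [g obg Jg] := ladder_butcher_reduction (Node a (t2 :: ts)) lad_t1.
by apply: (one_branch_leading (g := g)) => //; rewrite -tdeg_butcher in obg.
Qed.

End Jprime.

Theorem theorem13 (K : fieldType) (charK0 : [pchar K]%R =i pred0)
    (E : gradedSet) :
  (forall t : ptree E, normal_trees (Jprime K E) t -> is_ladder t) /\
  (forall t : ptree E, ~~ is_ladder t -> leading_trees (Jprime K E) t).
Proof.
split=> t; last exact: leading_trees_not_ladder.
by apply: contra_notT; apply: leading_trees_not_ladder.
Qed.
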